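(* For every integer $r\ge 1$ let $\mathscr{P}_{C_r}(q)$ be the $q$-analog of Kostant's partition function evaluated at the highest root of type $C_r$ (defined in the context). Then, as formal power series in $x$ with coefficients in $\mathbb{Z}[q]$, \[ \sum_{r\geq 1}\mathscr{P}_{C_r}(q)x^r=\frac{qx+(-q-q^2)x^2}{1-(2+2q+q^2)x+(1+2q+q^2+q^3)x^2}. \]
   Context: Type $C_r$ (the Lie algebra $\mathfrak{sp}_{2r}(\mathbb{C})$), $r\ge1$: with simple roots $\alpha_1,\dots,\alpha_r$ (where $\alpha_r$ is the long simple root), the positive roots are $\alpha_i+\alpha_{i+1}+\cdots+\alpha_j$ for $1\le i\le j\le r$; $\alpha_i+\cdots+\alpha_{j-1}+2\alpha_j+\cdots+2\alpha_{r-1}+\alpha_r$ for $1\le i<j\le r-1$; and $2\alpha_i+2\alpha_{i+1}+\cdots+2\alpha_{r-1}+\alpha_r$ for $1\le i\le r-1$. The highest root is $\tilde\alpha=2\alpha_1+2\alpha_2+\cdots+2\alpha_{r-1}+\alpha_r$ (for $r=1$ it is $\alpha_1$). A partition of $\tilde\alpha$ with $k$ parts is a multiset of $k$ positive roots (repetitions allowed) summing to $\tilde\alpha$. Then $\mathscr{P}_{C_r}(q)=\sum_{k\ge1}a_kq^k$, where $a_k$ is the number of partitions of $\tilde\alpha$ with exactly $k$ parts. *)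

(* Defs.v *)
From HB Require Import structures.
From mathcomp Require Import all_boot all_order all_algebra.
Set Implicit Arguments.
Unset Strict Implicit.
Unset Printing Implicit Defensive.
Import Order.TTheory GRing.Theory Num.Theory.
Local Open Scope ring_scope.

(* The root lattice of rank r is 'rV[int]_r, in coordinates with respect to   *)
(* the simple roots alpha 1, ..., alpha r, which are indexed from 1 as usual. *)
Definition alpha (r i : nat) : 'rV[int]_r := \row_(j < r) (i == j.+1)%:R.

Definition rootC1 (r i j : nat) : 'rV[int]_r :=
  \sum_(i <= l < j.+1) alpha r l.

Definition rootC2 (r i j : nat) : 'rV[int]_r :=
  \sum_(i <= l < j) alpha r l + \sum_(j <= l < r) alpha r l *+ 2 + alpha r r.

Definition rootC3 (r i : nat) : 'rV[int]_r :=
  \sum_(i <= l < r) alpha r l *+ 2 + alpha r r.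

(* index_iota m n enumerates m, ..., n - 1 *)
Definition posrootsC (r : nat) : seq 'rV[int]_r :=
  [seq rootC1 r i j | i <- index_iota 1 r.+1, j <- index_iota i r.+1] ++
  [seq rootC2 r i j | i <- index_iota 1 r, j <- index_iota i.+1 r] ++
  [seq rootC3 r i | i <- index_iota 1 r].

Definition highest_rootC (r : nat) : 'rV[int]_r :=
  \sum_(1 <= l < r) alpha r l *+ 2 + alpha r r.

(* A multiset of k elements of S is given by its multiplicity function, whose *)
(* values are at most k; seq_sub S is the finite type of the elements of S.   *)
Definition partitions (r : nat) (S : seq 'rV[int]_r) (mu : 'rV[int]_r)
    (k : nat) : {set {ffun seq_sub S -> 'I_k.+1}} :=
  [set m : {ffun seq_sub S -> 'I_k.+1} |
     ((\sum_(b : seq_sub S) (m b : nat))%N == k)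
     && (\sum_(b : seq_sub S) (val b) *+ (m b : nat) == mu)].

(* a_k *)
Definition npartC (r k : nat) : nat :=
  #|partitions (posrootsC r) (highest_rootC r) k|.

(* The variable q is 'X.  The sum over all k >= 1 stops at 2r - 1, the height *)
(* of the highest root: npartC_eq0 below shows that later terms vanish.       *)
Definition kostantC (r : nat) : {poly int} :=
  \sum_(1 <= k < r.*2) (npartC r k)%:R *: 'X^k.

Definition height (r : nat) (v : 'rV[int]_r) : int := \sum_(l < r) v 0 l.

Lemma heightD r (u v : 'rV[int]_r) : height (u + v) = height u + height v.
Proof. by rewrite -big_split; apply: eq_bigr => l _; rewrite mxE. Qed.

Lemma height0 r : height (0 : 'rV[int]_r) = 0.
Proof. by rewrite /height big1 // => l _; rewrite mxE. Qed.

Lemma heightMn r (v : 'rV[int]_r) n : height (v *+ n) = height v *+ n.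
Proof. by elim: n => [|n IH]; rewrite ?height0 // !mulrS heightD IH. Qed.

Lemma height_sum r (I : Type) (s : seq I) (F : I -> 'rV[int]_r) :
  height (\sum_(i <- s) F i) = \sum_(i <- s) height (F i).
Proof. exact: (big_morph _ (@heightD r) (height0 r)). Qed.

Lemma height_alpha r i : (0 < i <= r)%N -> height (alpha r i) = 1.
Proof.
case: i => // i /= lt_ir; rewrite /height (bigD1 (Ordinal lt_ir)) //= mxE eqxx.
rewrite big1 ?addr0 // => l ne_l; rewrite mxE eqSS.
by case: eqP => // Ei; case/eqP: ne_l; apply: val_inj.
Qed.

Lemma height_segment r i j c : (0 < i)%N -> (j <= r.+1)%N ->
  height (\sum_(i <= l < j) alpha r l *+ c) = (c * (j - i))%:R.
Proof.
move=> i0 jr; rewrite height_sum (@eq_big_nat _ _ _ _ _ _ (fun=> c%:R)).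
  by rewrite big_const_nat iter_addr_0 -mulrnA.
move=> l /andP[il lj]; rewrite heightMn height_alpha //.
by rewrite (leq_trans i0 il) -ltnS (leq_trans lj jr).
Qed.

Lemma height_segment1 r i j : (0 < i)%N -> (j <= r.+1)%N ->
  height (\sum_(i <= l < j) alpha r l) = (j - i)%:R.
Proof.
move=> i0 jr; rewrite -[(j - i)%N]mul1n -(@height_segment r i j 1) //.
Qed.

Lemma height_posrootC r b : b \in posrootsC r -> 1 <= height b.
Proof.
rewrite !mem_cat => /or3P[/allpairsPdep[i [j []]]|/allpairsPdep[i [j []]]|].
- rewrite !mem_index_iota => /andP[i0 _] /andP[ij jr] ->.
  by rewrite height_segment1 // subSn // ler1n.
- rewrite !mem_index_iota => /andP[i0 ir] /andP[ij jr] ->.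
  rewrite !heightD height_segment1 ?height_segment ?height_alpha //.
  + by rewrite lerDr addr_ge0 ?ler0n.
  + by rewrite leqnn (leq_trans _ jr).
  + exact: leq_trans i0 (ltnW ij).
  + exact: leqW (ltnW jr).
case/mapP => i; rewrite mem_index_iota => /andP[i0 ir] ->.
rewrite heightD height_segment ?height_alpha //.
- by rewrite lerDr ler0n.
- by rewrite leqnn (leq_trans _ ir).
Qed.

Lemma height_highest_rootC r :
  (0 < r)%N -> height (highest_rootC r) = r.*2.-1%:R.
Proof.
move=> r0; rewrite heightD height_segment // height_alpha ?r0 ?leqnn //.
by case: r r0 => // r _; rewrite subn1 mul2n doubleS /= -natr1.
Qed.

Lemma npartC_eq0 r k : (0 < r)%N -> (r.*2 <= k)%N -> npartC r k = 0%N.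
Proof.
move=> r0 rk; apply/eqP; rewrite cards_eq0; apply/eqP/setP=> m.
rewrite !inE; apply/negP => /andP[/eqP sumk /eqP summu].
have: height (\sum_(b : seq_sub (posrootsC r)) val b *+ m b) >= k%:R.
  rewrite height_sum -[in k%:R]sumk natr_sum; apply: ler_sum => b _.
  by rewrite heightMn lerMn2r height_posrootC ?orbT // (valP b).
rewrite summu height_highest_rootC // ler_nat => kr.
by have := leq_trans rk kr; case: r r0 {m sumk summu rk kr} => // r _;
  rewrite doubleS ltnn.
Qed.

(* Formal power series over R, given by their coefficients. *)
Definition fps (R : Type) := nat -> R.

Section FPS.
Variable R : comUnitRingType.

Definition fps_of_poly (p : {poly R}) : fps R := fun n => p`_n.

Definition fps_mul (f g : fps R) : fps R :=
  fun n => \sum_(i < n.+1) f i * g (n - i)%N.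

(* The first n coefficients of the inverse; only meaningful when the constant *)
(* coefficient of f is a unit, see fps_mulV.                                  *)
Fixpoint fps_inv_prefix (f : fps R) (n : nat) : seq R :=
  if n is m.+1 then
    let s := fps_inv_prefix f m in
    rcons s ((f 0%N)^-1 * ((m == 0%N)%:R - \sum_(i < m) f (m - i)%N * s`_i))
  else [::].

Definition fps_inv (f : fps R) : fps R := fun n => (fps_inv_prefix f n.+1)`_n.

Definition fps_div (f g : fps R) : fps R := fps_mul f (fps_inv g).

Lemma size_fps_inv_prefix f n : size (fps_inv_prefix f n) = n.
Proof. by elim: n => //= n IH; rewrite size_rcons IH. Qed.

Lemma nth_fps_inv_prefix f n i :
  (i < n)%N -> (fps_inv_prefix f n)`_i = fps_inv f i.
Proof.
elim: n => // n IH; rewrite ltnS leq_eqVlt => /orP[/eqP->//|lt_in].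
by rewrite /= nth_rcons size_fps_inv_prefix lt_in IH.
Qed.

Lemma fps_invE f n : fps_inv f n =
  (f 0%N)^-1 * ((n == 0%N)%:R - \sum_(i < n) f (n - i)%N * fps_inv f i).
Proof.
rewrite /fps_inv /= nth_rcons size_fps_inv_prefix ltnn eqxx.
by under eq_bigr => i _ do rewrite nth_fps_inv_prefix //.
Qed.

Lemma fps_mulV f : f 0%N \is a GRing.unit ->
  fps_mul f (fps_inv f) =1 fps_of_poly 1.
Proof.
move=> Uf n; rewrite /fps_mul /fps_of_poly coef1 (reindex_inj rev_ord_inj) /=.
rewrite big_ord_recr /= subnn subn0 [fps_inv f n]fps_invE mulrA divrr // mul1r.
rewrite [X in X + _](eq_bigr (fun i : 'I_n => f (n - i)%N * fps_inv f i)).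
  by rewrite addrC subrK.
by move=> i _; rewrite subSS subKn // ltnW.
Qed.

End FPS.

Definition kostantC_series : fps {poly int} :=
  fun r => if r is _.+1 then kostantC r else 0.

(* Main.v *)
(** Write the positive roots as [e_a - e_c] ([a < c]) and [e_c + e_a]
    ([c <= a]), so that the highest root is [2 e_0].  Exactly one part of a
    partition of it is of the second kind; cutting that part [e_c + e_a] into
    two strands, starting at [c] and at [a] and both running to the end, turns
    the partition into a multiset of intervals that covers every position
    exactly twice.  Scanning the positions from left to right and recording the
    starting points of the two intervals covering the current position gives a
    walk on two-element multisets, in which a step keeps a sub-multiset and
    fills up with the new position.  The weighted number of continuations
    depends only on whether the two recorded points coincide; the resulting
    2 x 2 transfer matrix has trace [2 + 2q + q^2] and determinant
    [1 + 2q + q^2 + q^3]. *)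

Require Import Defs.
From mathcomp Require Import all_boot all_order all_algebra zify ring.
Set Implicit Arguments.
Unset Strict Implicit.
Unset Printing Implicit Defensive.
Import Order.TTheory GRing.Theory Num.Theory.

(** * Walks on two-element multisets *)

(* A two-element multiset is encoded by its sorted pair of elements. *)
Definition cnt (v : nat * nat) (x : nat) : nat := (v.1 == x) + (v.2 == x).

(** Splitting on [v.1 == v.2] keeps the list free of repetitions: dropping either of two equal
    entries leaves the same multiset. *)
Definition succs (l : nat) (v : nat * nat) : seq (nat * nat) :=
  if v.1 == v.2 then [:: v; (v.1, l); (l, l)]
  else [:: v; (v.1, l); (v.2, l); (l, l)].

Fixpoint walks (n l : nat) (v : nat * nat) : seq (seq (nat * nat)) :=
  if n is n'.+1 then
    [seq u :: t | u <- succs l v, t <- walks n' l.+1 u]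
  else [:: [::]].

Fixpoint walk_weight (l : nat) (t : seq (nat * nat)) : nat :=
  if t is u :: t' then cnt u l + walk_weight l.+1 t' else 0.

(** Both multisets have size two, so not exceeding [v] below [l] amounts to keeping part of [v] and
    filling up with copies of [l]. *)
Lemma succsP l v u : v.1 <= v.2 < l ->
  u \in succs l v <-> u.1 <= u.2 <= l /\
    forall x, x < l -> cnt u x <= cnt v x.
Proof.
case: v u => a b [c d] /= /andP[ab bl]; split.
  rewrite /succs /cnt /=; case: (a =P b) => Eab; rewrite !inE !xpair_eqE => H.
    by split=> [|x xl]; lia.
  by split=> [|x xl]; lia.
rewrite /cnt /= => -[cdl H]; have := H c.
case: (d =P l) => [->|dl]; last have := H d.
  rewrite /succs /=; case: (a =P b) => Eab; rewrite !inE !xpair_eqE; lia.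
rewrite /succs /=; case: (a =P b) => Eab; rewrite !inE !xpair_eqE; lia.
Qed.

Lemma walksP n l v t : v.1 <= v.2 < l ->
  t \in walks n l v <-> size t = n /\ forall i, i < n ->
    let u := nth v t i in let u' := nth v (v :: t) i in
    u.1 <= u.2 <= l + i /\ forall x, x < l + i -> cnt u x <= cnt u' x.
Proof.
elim: n l v t => [|n IH] l v t vl /=.
  by rewrite inE; split=> [/eqP->//|[/size0nil->]].
split.
  case/allpairsPdep=> u [t' [/(succsP _ vl) uv t'u ->]].
  have ul : u.1 <= u.2 < l.+1 by rewrite ltnS; case: uv.
  have [st' H] := (IH _ _ _ ul).1 t'u.
  split=> [|[|i] ilt /=]; first by rewrite /= st'.
    by rewrite addn0.
  have := H i ilt; rewrite addSnnS.
  rewrite !(set_nth_default u v) //= ?st' //; exact: ltnW.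
case: t => [[]//|u t] [[st] H].
have uv := H 0 isT; rewrite /= addn0 in uv.
have ul : u.1 <= u.2 < l.+1 by rewrite ltnS; case: uv.
apply/allpairsPdep; exists u, t; split=> //; first exact/succsP.
apply/(IH _ _ _ ul); split=> // i ilt.
have := H i.+1 ilt; rewrite /= -addSnnS.
rewrite !(set_nth_default u v) //= ?st //; exact: ltnW.
Qed.

Lemma walks_uniq n l v : v.1 <= v.2 < l -> uniq (walks n l v).
Proof.
elim: n l v => [|n IH] l v vl //=.
apply: allpairs_uniq_dep => [|u /(succsP _ vl)[ul _]|[u t] [u' t'] _ _ /=].
- rewrite /succs; case: v vl => a b /= vl; case: (a =P b) => Eab;
   rewrite /= !inE !xpair_eqE; lia.
- by apply: IH; rewrite ltnS.
by case=> -> ->.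
Qed.

Lemma walk_weightE l v t :
  walk_weight l t = \sum_(i < size t) cnt (nth v t i) (l + i).
Proof.
elim: t l => [|u t IH] l /=; first by rewrite big_ord0.
rewrite big_ord_recl addn0 IH; congr addn; apply: eq_bigr => i _.
by rewrite addSnnS.
Qed.

Lemma walk_weight_le l t : walk_weight l t <= (size t).*2.
Proof.
elim: t l => //= u t IH l; have := IH l.+1.
have : cnt u l <= 2 by rewrite /cnt; lia.
lia.
Qed.

(** * Multiplicity functions covering every position twice *)

(* The coefficient of the root with index (a, c) at position l; for the roots
   [e_c + e_a] the last coefficient is doubled, so that they count
   two strands. *)
Definition coverage (a c l : nat) : nat :=
  (a <= l < c) + (c <= a <= l) + ((c <= a) && (c <= l)).

Lemma sum_delta N (Q : pred nat) x b : x < N ->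
  \sum_(a < N | Q a) ((x == a) && b) = (Q x && b).
Proof.
move=> xN; rewrite big_mkcond (bigD1 (Ordinal xN)) //= eqxx big1 => [|i].
  by rewrite addn0; case: (Q x).
by rewrite -val_eqE /= eq_sym => /negPf->; case: ifP.
Qed.

Lemma sum_delta1 N (Q : pred nat) x : x < N ->
  \sum_(a < N | Q a) (x == a) = Q x.
Proof.
move=> /(sum_delta Q true); rewrite andbT => <-.
by apply: eq_bigr => i _; rewrite andbT.
Qed.

Lemma sum_cnt N l v : v.1 <= l -> v.2 <= l -> l < N ->
  \sum_(a < N | a <= l) cnt v a = 2.
Proof.
move=> v1 v2 lN; rewrite big_split /= !(sum_delta1 (fun a => a <= l)).
- by rewrite v1 v2.
- exact: leq_ltn_trans lN.
- exact: leq_ltn_trans lN.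
Qed.

Lemma cnt_inj l v v' : v.1 <= v.2 <= l -> v'.1 <= v'.2 <= l ->
  (forall a, a <= l -> cnt v a = cnt v' a) -> v = v'.
Proof.
case: v v' => [a b] [a' b'] /= H H' E.
have bb' : b = b' by have := E b; have := E b'; rewrite /cnt /=; lia.
rewrite -{}bb' in H' E *; have := E a; rewrite /cnt /= => Ea.
by congr pair; lia.
Qed.

Lemma sum_eq1_delta N (g : nat -> nat) : \sum_(a < N) g a = 1 ->
  exists2 b, b < N & forall a, a < N -> g a = (b == a).
Proof.
move=> /eqP/sum_nat_eq1[i [_ Ei E]]; exists i => // a aN.
have [<-//|ne] := eqVneq (i : nat) a.
by rewrite (E (Ordinal aN)) // -val_eqE eq_sym.
Qed.

(** Peeling off the last value, which is 0, 1 or 2, leaves the same problem, a single point, or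
    nothing. *)
Lemma sum_eq2_cnt N (g : nat -> nat) : \sum_(a < N) g a = 2 ->
  exists2 v, v.1 <= v.2 < N & forall a, a < N -> cnt v a = g a.
Proof.
elim: N => [|N IH]; first by rewrite big_ord0.
rewrite big_ord_recr /= => S2.
have [g0|g1|g2] : [\/ g N = 0, g N = 1 | g N = 2].
- by case: (g N) S2 => [|[|[|m]]];
    [constructor 1|constructor 2|constructor 3|lia].
- have [|v vN E] := IH; first by rewrite g0 addn0 in S2.
  exists v => [|a]; first lia.
  by rewrite ltnS leq_eqVlt => /orP[/eqP->|/E//]; rewrite /cnt; lia.
- have [|b bN E] := @sum_eq1_delta N g.
    by move: S2; rewrite g1 addn1 => -[].
  exists (b, N) => [|a]; first by rewrite /=; lia.
  rewrite ltnS leq_eqVlt => /orP[/eqP->|aN]; first by rewrite /cnt /=; lia.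
  by rewrite E // /cnt /=; lia.
have /eqP : \sum_(i < N) g i = 0 by move: S2; rewrite g2 addn2 => -[].
rewrite sum_nat_eq0 => /forallP g0.
exists (N, N) => [|a]; first by rewrite /=; lia.
rewrite ltnS leq_eqVlt => /orP[/eqP->|aN]; first by rewrite /cnt /=; lia.
by have := g0 (Ordinal aN) => /= /eqP; rewrite /cnt /=; lia.
Qed.

(* For a <= l, the number of strands that start at a and cover l. *)
Definition open_at n (f : nat -> nat -> nat) a l :=
  \sum_(c < n.+1 | (l < c) || (c <= a)) f a c + \sum_(c < n.+1 | a <= c) f c a.

(** This encodes summing to the highest root: its last coefficient is 1, but [coverage] doubles that
    position, so the value 2 is uniform. *)
Definition covers n (f : nat -> nat -> nat) := forall l, l <= n ->
  \sum_(a < n.+1) \sum_(c < n.+1) f a c * coverage a c l = 2.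

(** Double counting of the strands covering [l]; a root [(a, c)] with [c <= a] gives one strand from
    [a] and one from [c]. *)
Lemma sum_open_at n f l : \sum_(a < n.+1 | a <= l) open_at n f a l =
  \sum_(a < n.+1) \sum_(c < n.+1) f a c * coverage a c l.
Proof.
rewrite big_split /= [X in _ + X](exchange_big_dep predT) //=.
rewrite [X in X + _]big_mkcond -big_split /=; apply: eq_bigr => a _.
rewrite [X in _ + X]big_mkcond /=.
case: leqP => al; last first.
  by rewrite add0n; apply: eq_bigr => c _; rewrite /coverage; case: ifP; nia.
rewrite [X in X + _]big_mkcond -big_split /=; apply: eq_bigr => c _.
by rewrite /coverage; do 2 case: ifP; nia.
Qed.

(** At the last position a root with [a < c] contributes 0 and any other root 2. *)
Lemma sum_special n f : covers n f ->
  \sum_(a < n.+1) \sum_(c < n.+1 | c <= a) f a c = 1.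
Proof.
move=> /(_ n (leqnn n)) H; apply/eqP.
rewrite -(eqn_pmul2r (isT : 0 < 2)) mul1n -[X in _ == X]H big_distrl /=.
apply/eqP/eq_bigr => a _; rewrite big_distrl big_mkcond /=.
apply: eq_bigr => c _; have := ltn_ord a; have := ltn_ord c.
by rewrite /coverage; case: ifP; nia.
Qed.

(** Every part starts one strand, except the unique part of the second kind, which starts two. *)
Lemma sum_open_diag n f : covers n f -> \sum_(a < n.+1) open_at n f a a =
  (\sum_(a < n.+1) \sum_(c < n.+1) f a c).+1.
Proof.
move=> cf; rewrite big_split /= -[RHS]addn1; congr addn.
  by apply: eq_bigr => a _; apply: eq_bigl => c; lia.
by rewrite -[RHS](sum_special cf) (exchange_big_dep predT).
Qed.

(* The strands from a ending at c are those lost between c - 1 and c; the two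
   strands alive at the last position n come from the unique root
   [e_c + e_a]. *)
Definition walk_mult n (P : nat -> nat * nat) a c : nat :=
  if a < c then cnt (P c.-1) a - cnt (P c) a else P n == (c, a).

(** At [l = 0] the bounds force [P 0 = (0, 0)]; the second clause leaves the count of the new
    position [l.+1] free. *)
Definition is_walk n (P : nat -> nat * nat) :=
  (forall l, l <= n -> (P l).1 <= (P l).2 <= l) /\
  (forall l x, l < n -> x <= l -> cnt (P l.+1) x <= cnt (P l) x).

(** From position [a] on, the count of [a] never increases, so the truncated differences are genuine
    and telescope. *)
Lemma cnt_telescope n P a l N : is_walk n P -> a <= l <= N -> N <= n ->
  cnt (P N) a <= cnt (P l) a /\
  \sum_(c < N.+1 | l < c) (cnt (P c.-1) a - cnt (P c) a) =
    cnt (P l) a - cnt (P N) a.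
Proof.
move=> [Ps Pd] /andP[al]; elim: N => [|N IH].
  rewrite leqn0 => /eqP-> _; split=> //.
  by rewrite big_mkcond big_ord_recl big_ord0 /= subnn.
rewrite leq_eqVlt => /orP[/eqP-> _|lN Nn].
  split=> //; rewrite subnn big1 // => c; have := ltn_ord c; lia.
have [] := IH lN (ltnW Nn).
rewrite big_mkcond [in X in _ -> _ /\ X]big_mkcond /=.
rewrite [in X in _ -> _ /\ X]big_ord_recr /= => H1 ->.
have := Pd N a Nn (leq_trans al lN); have -> : l < N.+1 by []; lia.
Qed.

(** The strands from [a] that end after [l] telescope to [cnt (P l) a - cnt (P n) a]; the rest comes
    from the root of the second kind, encoded by [P n]. *)
Lemma open_at_walk_mult n P a l : is_walk n P -> a <= l <= n ->
  open_at n (walk_mult n P) a l = cnt (P l) a.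
Proof.
move=> vP aln; have [H1 H2] := cnt_telescope vP aln (leqnn n).
have /andP[P12 Pn] := (vP.1 n (leqnn n)).
rewrite /open_at (bigID (fun c : 'I_n.+1 => l < c)) /=.
rewrite (eq_big (fun c : 'I_n.+1 => l < c)
    (fun c : 'I_n.+1 => cnt (P c.-1) a - cnt (P c) a)); first last.
- by move=> c lc; rewrite /walk_mult; case: ifP; lia.
- by move=> c; lia.
rewrite H2 (eq_big (fun c : 'I_n.+1 => c <= a)
    (fun c : 'I_n.+1 => (((P n).1 == c) && ((P n).2 == a) : nat))); first last.
- by move=> c lc; rewrite /walk_mult; case: ifP; [lia | rewrite -pair_eqE].
- by move=> c; lia.
rewrite [X in _ + X](eq_bigr
    (fun c : 'I_n.+1 => (((P n).2 == c) && ((P n).1 == a) : nat))); last first.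
  by move=> c lc; rewrite /walk_mult; case: ifP;
    [lia | rewrite -pair_eqE /= andbC].
rewrite (sum_delta (fun c => c <= a)) ?(sum_delta (fun c => a <= c)); try lia.
by move: H1; rewrite /cnt; lia.
Qed.

Lemma covers_walk_mult n P : is_walk n P -> covers n (walk_mult n P).
Proof.
move=> vP l ln; rewrite -sum_open_at -[RHS](@sum_cnt n.+1 l (P l)) //.
- by apply: eq_bigr => a al; rewrite open_at_walk_mult // al.
- by have := vP.1 l ln; lia.
- by have := vP.1 l ln; lia.
Qed.

(** Inverse construction: [P l] is the multiset with multiplicities [open_at n f a l], whose total
    is 2 because [f] covers [l] twice. *)
Lemma covers_walkP n f : covers n f -> exists2 P, is_walk n P &
  (forall a c, a <= n -> c <= n -> walk_mult n P a c = f a c).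
Proof.
move=> cf.
have /fin_all_exists[F HF] (l : 'I_n.+1) : exists v, v.1 <= v.2 <= l /\
    forall a, a <= l -> cnt v a = open_at n f a l.
  have [|v vl E] := @sum_eq2_cnt l.+1 (fun a => open_at n f a l); last first.
    by exists v.
  have ln : l <= n by rewrite -ltnS.
  rewrite -[RHS](cf l ln) -sum_open_at.
  by rewrite (big_ord_widen n.+1 (fun a => open_at n f a l)).
pose P l := F (inord l).
have PE l : l <= n -> (P l).1 <= (P l).2 <= l /\
    forall a, a <= l -> cnt (P l) a = open_at n f a l.
  by move=> ln; have := HF (inord l); rewrite inordK.
(* As [l] grows, the first sum in [open_at] only loses terms and the second is constant. *)
have vP : is_walk n P.
  split=> [l ln|l x ln xl]; first by have [] := PE l ln.
  rewrite (PE _ ln).2 ?(PE _ (ltnW ln)).2 ?leqW // leq_add2r.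
  rewrite big_mkcond [X in _ <= X]big_mkcond /=; apply: leq_sum => c _.
  by do 2 case: ifP; lia.
have [[a0 c0] /= c0a0 fE] : exists2 p : 'I_n.+1 * 'I_n.+1, p.2 <= p.1 &
    forall a c, c <= a <= n -> f a c = (p.1 == a :> nat) && (p.2 == c :> nat).
  have := sum_special cf; rewrite pair_big_dep => /eqP/sum_nat_eq1[p [pP Ep E]].
  exists p => // a c /andP[ca an]; have cn : c < n.+1 := leq_trans ca an.
  have [pac|npac] := eqVneq (Ordinal (an : a < n.+1), Ordinal cn) p.
    by move: Ep; rewrite -pac /= !eqxx.
  rewrite (E _ npac) //; apply/esym/eqP; rewrite eqb0.
  apply: contra npac; case: (p) => x y /=.
  by rewrite -pair_eqE /= -!val_eqE /= !(eq_sym a) !(eq_sym c).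
exists P => // a c an cn; rewrite /walk_mult; case: ltnP => [ac|ca].
  rewrite (PE c cn).2 ?(PE c.-1 _).2; try lia.
  (* Passing from [c.-1] to [c] removes from the first sum exactly the term [f a c]. *)
  rewrite /open_at subnDr (bigD1 (Ordinal (cn : c < n.+1))) /=; last lia.
  set S := (X in _ + X - _); rewrite (_ : \sum_(x < _ | _) _ = S) ?addnK //.
  by apply: eq_bigl => x; rewrite -val_eqE /=; lia.
(* At position [n] only the two strands of the unique root of the second kind, [(a0, c0)], are
   alive. *)
suff -> : P n = (c0 : nat, a0 : nat).
  by rewrite fE ?ca // -pair_eqE /= andbC.
have a0n := ltn_ord a0; have c0n := ltn_ord c0.
apply: (@cnt_inj n) => [||x xn].
- by have [] := PE n (leqnn n).
- by rewrite /=; lia.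
rewrite (PE n (leqnn n)).2 // /open_at.
rewrite (eq_big (fun c : 'I_n.+1 => c <= x)
   (fun c : 'I_n.+1 => ((c0 == c :> nat) && (a0 == x :> nat) : nat)));
   first last.
- by move=> y yx; rewrite fE; [rewrite andbC | have := ltn_ord y; lia].
- by move=> y; have := ltn_ord y; lia.
rewrite [X in _ + X](eq_bigr
   (fun c : 'I_n.+1 => ((a0 == c :> nat) && (c0 == x :> nat) : nat)));
   last first.
  by move=> y yx; rewrite fE; [|have := ltn_ord y; lia].
rewrite (sum_delta (fun c => c <= x)) ?(sum_delta (fun c => x <= c)) //.
by rewrite /cnt /=; lia.
Qed.

(** * From roots to walks *)

Local Open Scope ring_scope.

(** The $r^2$ pairs index the $r^2$ positive roots; the last coefficient is half of [coverage]. *)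
Definition pair_root (r : nat) (p : 'I_r * 'I_r) : 'rV[int]_r :=
  \row_l (if l.+1 == r then ((p.2 <= p.1)%N : nat) else coverage p.1 p.2 l)%:R.

Lemma sum_alphaE r i j c (l : 'I_r) :
  (\sum_(i <= x < j) alpha r x *+ c) 0 l = ((i <= l.+1 < j) * c)%:R.
Proof.
rewrite summxE; elim: j => [|j IH]; first by rewrite big_geq // andbF.
case: (leqP i j) => ij; last by rewrite big_geq // (_ : _ && _ = false) //; lia.
rewrite big_nat_recr //= IH mulmxnE mxE -mulrnA -natrD; congr _%:R.
by case: eqP; lia.
Qed.

Lemma sum_alpha1E r i j (l : 'I_r) :
  (\sum_(i <= x < j) alpha r x) 0 l = (i <= l.+1 < j)%:R.
Proof. by have := sum_alphaE i j 1 l; rewrite muln1 => <-. Qed.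

Lemma highest_rootCE r (l : 'I_r) :
  highest_rootC r 0 l = (if l.+1 == r then 1 else 2)%N%:R.
Proof.
rewrite /highest_rootC mxE sum_alphaE mxE -natrD; congr _%:R.
by have := ltn_ord l; case: ifP; lia.
Qed.

(** The last coefficient separates the two kinds; within a kind, testing at the ends of the
    intervals of both pairs recovers the pair. *)
Lemma pair_root_inj r : injective (@pair_root r).
Proof.
move=> [a c] [a' c'] /rowP E.
have {}E l : (l < r)%N ->
  ((if l.+1 == r then (c <= a)%N : nat else coverage a c l) =
   (if l.+1 == r then (c' <= a')%N : nat else coverage a' c' l))%N.
  move=> lr; have := E (Ordinal lr); rewrite !mxE /= => /eqP.
  by rewrite eqr_nat => /eqP.
suff: (a = a' :> nat) /\ (c = c' :> nat) by case=> /val_inj-> /val_inj->.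
have ar := ltn_ord a; have cr := ltn_ord c.
have a'r := ltn_ord a'; have c'r := ltn_ord c'.
have E0 : (c <= a)%N = (c' <= a')%N.
  by have := E r.-1; rewrite (_ : r.-1.+1 == r); lia.
have {}E l : (l < r)%N -> coverage a c l = coverage a' c' l.
  move=> lr; have := E l lr; case: eqP => // El _.
  by rewrite /coverage; lia.
case: (leqP c a) E0 => [ca|ac] /esym E0.
  have := E a ar; have := E a' a'r.
  by have := E c cr; have := E c' c'r; rewrite /coverage; lia.
have key l : (l < r)%N -> (a <= l < c)%N = (a' <= l < c')%N.
  by move=> /E; rewrite /coverage; lia.
have /andP[? ?] : (a' <= a < c')%N by rewrite -key // leqnn.
have /andP[? ?] : (a <= a' < c)%N by rewrite key // leqnn; lia.
have /andP[? ?] : (a' <= c.-1 < c')%N by rewrite -key; lia.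
have /andP[? ?] : (a <= c'.-1 < c)%N by rewrite key; lia.
by clear E key; lia.
Qed.

(** Dictionary: [rootC1 i j] with [j < r] has index [(i.-1, j)], [rootC2 i j] has [(j.-1, i.-1)],
    and [rootC3 i] has [(i.-1, i.-1)]. *)
Lemma mem_posrootsC r (b : 'rV[int]_r) :
  b \in posrootsC r <-> exists p, b = pair_root p.
Proof.
split.
  rewrite !mem_cat => /or3P[/allpairsPdep[i [j []]]|/allpairsPdep[i [j []]]|].
  - rewrite !mem_index_iota => i_r ij ->.
    have [jr|jr] := ltnP j r.
      have ir : (i.-1 < r)%N by lia.
      exists (Ordinal ir, Ordinal jr); apply/rowP => l.
      rewrite sum_alpha1E mxE /=; congr _%:R; have := ltn_ord l.
      by rewrite /coverage; case: ifP; lia.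
    (* An interval reaching [r] contains the long root $\alpha_r = 2 e_{r-1}$, so it is of the
       second kind, with strands from [i.-1] and [r.-1]. *)
    have ir : (i.-1 < r)%N by lia.
    have jr' : (r.-1 < r)%N by lia.
    exists (Ordinal jr', Ordinal ir); apply/rowP => l.
    rewrite sum_alpha1E mxE /=; congr _%:R; have := ltn_ord l.
    by rewrite /coverage; case: ifP; lia.
  - rewrite !mem_index_iota => i_r ij ->.
    have ir : (i.-1 < r)%N by lia.
    have jr : (j.-1 < r)%N by lia.
    exists (Ordinal jr, Ordinal ir); apply/rowP => l.
    rewrite !mxE sum_alpha1E sum_alphaE /= -!natrD; congr _%:R.
    by have := ltn_ord l; rewrite /coverage; case: ifP; lia.
  case/mapP => i; rewrite mem_index_iota => i_r ->.
  have ir : (i.-1 < r)%N by lia.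
  exists (Ordinal ir, Ordinal ir); apply/rowP => l.
  rewrite !mxE sum_alphaE /= -!natrD; congr _%:R.
  by have := ltn_ord l; rewrite /coverage; case: ifP; lia.
case=> -[[a ar] [c cr]] ->; rewrite !mem_cat.
have [ac|ca] := ltnP a c.
  apply/orP; left; apply/allpairsPdep; exists a.+1, c.
  rewrite !mem_index_iota; split; [lia|lia|].
  apply/rowP => l; rewrite sum_alpha1E mxE /=; congr _%:R.
  by have := ltn_ord l; rewrite /coverage; case: ifP; lia.
have [ar'|ar'] := eqVneq a.+1 r.
  apply/orP; left; apply/allpairsPdep; exists c.+1, r.
  rewrite !mem_index_iota; split; [lia|lia|].
  apply/rowP => l; rewrite sum_alpha1E mxE /=; congr _%:R.
  by have := ltn_ord l; rewrite /coverage; case: ifP; lia.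
apply/orP; right; apply/orP; have [ac|ac] := eqVneq a c; [right|left].
  apply/mapP; exists a.+1; rewrite ?mem_index_iota; first lia.
  apply/rowP => l; rewrite !mxE sum_alphaE /= -!natrD; congr _%:R.
  by have := ltn_ord l; rewrite /coverage; case: ifP; lia.
apply/allpairsPdep; exists c.+1, a.+1.
rewrite !mem_index_iota; split; [lia|lia|].
apply/rowP => l; rewrite !mxE sum_alpha1E sum_alphaE /= -!natrD; congr _%:R.
by have := ltn_ord l; rewrite /coverage; case: ifP; lia.
Qed.

Definition pair_partitions (r k : nat) : {set {ffun 'I_r * 'I_r -> 'I_k.+1}} :=
  [set m : {ffun 'I_r * 'I_r -> 'I_k.+1} | ((\sum_p m p)%N == k) &&
     [forall l : 'I_r, (\sum_p m p * coverage p.1 p.2 l)%N == 2%N]].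

Lemma npartC_pairs r k : npartC r k = #|pair_partitions r k|.
Proof.
have root_in p : pair_root p \in posrootsC r by apply/mem_posrootsC; exists p.
pose f p : seq_sub (posrootsC r) := SeqSub (root_in p).
have f_inj : injective f by move=> p p' [] /pair_root_inj.
have f_onto b : b \in codom f.
  have /mem_posrootsC[p Ep] := valP b.
  by apply/codomP; exists p; apply: val_inj.
have f_bij : bijective f by exists (fun b => iinv (f_onto b)) => x;
  [apply: f_inj; rewrite f_iinv | rewrite f_iinv].
have [g fK gK] := f_bij.
pose F (m : {ffun seq_sub (posrootsC r) -> 'I_k.+1}) := [ffun p => m (f p)].
have F_inj : injective F.
  move=> m m' /ffunP E; apply/ffunP=> b.
  by have := E (g b); rewrite !ffunE gK.
rewrite /npartC -(card_imset _ F_inj); congr #|pred_of_set _|.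
apply/setP=> m'; have [m ->] : exists m, m' = F m.
  by exists [ffun b => m' (g b)]; apply/ffunP=> p; rewrite !ffunE fK.
rewrite mem_imset //.
rewrite !inE (reindex f) /=; last exact: onW_bij.
congr (_ && _); first by congr (_ == _); apply: eq_bigr => p _; rewrite !ffunE.
rewrite (reindex f) /=; last exact: onW_bij.
have coordE (l : 'I_r) :
    ((\sum_p pair_root p *+ m (f p)) 0 l == highest_rootC r 0 l)
    = ((\sum_p F m p * coverage p.1 p.2 l)%N == 2%N).
  rewrite highest_rootCE summxE.
  rewrite (eq_bigr (fun p => (m (f p) * (if l.+1 == r then (p.2 <= p.1)%N : nat
    else coverage p.1 p.2 l))%:R)) => [|p _];
    last by rewrite mulmxnE mxE -mulrnA mulnC.
  rewrite -natr_sum eqr_nat; case: (l.+1 =P r) => [El|_]; last first.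
    by congr (_ == _); apply: eq_bigr => p _; rewrite ffunE.
  (* The equation at the last coordinate is doubled to match [coverage]. *)
  rewrite -(eqn_pmul2r (isT : 0 < 2)%N) big_distrl /= mul1n; congr (_ == _).
  apply: eq_bigr => p _; rewrite ffunE -mulnA; congr (_ * _)%N.
  by have := (ltn_ord p.1, ltn_ord p.2); rewrite /coverage; case; lia.
apply/eqP/forallP => [E l|E]; first by rewrite -coordE E.
by apply/rowP => l; apply/eqP; rewrite coordE.
Qed.

Local Close Scope ring_scope.

Lemma card_bij_seq (T : finType) (U : eqType) (A : {set T}) (s : seq U)
    (G : U -> T) :
  uniq s -> {in s &, injective G} -> (forall u, u \in s -> G u \in A) ->
  (forall m, m \in A -> exists2 u, u \in s & G u = m) -> #|A| = size s.
Proof.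
move=> Us Ginj GA Gonto; rewrite cardE -(size_map G s); apply: perm_size.
apply: uniq_perm; rewrite ?enum_uniq ?map_inj_in_uniq // => m.
rewrite mem_enum; apply/idP/mapP => [/Gonto[u us <-]|[u us ->]]; last exact: GA.
by exists u.
Qed.

(** Two strands start at position 0 and [walk_weight 1 t] later; there is one part fewer than there
    are strands. *)
Lemma npartC_walks n k :
  npartC n.+1 k = count (fun t => (walk_weight 1 t).+1 == k) (walks n 1 (0, 0)).
Proof.
pose Pt t := nth (0, 0) ((0, 0) :: t).
have tP t : t \in walks n 1 (0, 0) -> size t = n /\ is_walk n (Pt t).
  move=> /(@walksP n 1 (0, 0) t isT)[st H]; split=> //; split.
    by case=> [|l] //= ln; have [] := H l ln; rewrite add1n.
  by move=> l x ln xl; have [_] := H l ln; apply; rewrite add1n ltnS.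
have totP P : is_walk n P -> P 0 = (0, 0) ->
  \sum_(p : 'I_n.+1 * 'I_n.+1) walk_mult n P p.1 p.2
     = (\sum_(i < n) cnt (P i.+1) i.+1).+1.
  move=> vP P0; apply: succn_inj.
  rewrite -(pair_bigA _ (fun a c : 'I_n.+1 => walk_mult n P a c)).
  rewrite -(sum_open_diag (covers_walk_mult vP)).
  rewrite big_ord_recl open_at_walk_mult // P0 /=; congr (_.+2).
  by apply: eq_bigr => i _; rewrite open_at_walk_mult // leqnn;
    have := ltn_ord i.
have wtP t : size t = n -> \sum_(i < n) cnt (Pt t i.+1) i.+1 = walk_weight 1 t.
  move=> st; rewrite (walk_weightE 1 (0, 0)) st.
  by apply: eq_bigr => i _; rewrite add1n.
pose G t : {ffun 'I_n.+1 * 'I_n.+1 -> 'I_k.+1} :=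
  [ffun p : 'I_n.+1 * 'I_n.+1 => inord (walk_mult n (Pt t) p.1 p.2)].
(* Each multiplicity is at most the number of parts [k], so [inord] never falls back to its
   default. *)
have GE t p : t \in walks n 1 (0, 0) -> (walk_weight 1 t).+1 = k ->
    G t p = walk_mult n (Pt t) p.1 p.2 :> nat.
  move=> /tP[st vt] wk; rewrite ffunE inordK // ltnS -wk -wtP // -totP //.
  by rewrite (bigD1 p) //= leq_addr.
rewrite npartC_pairs -size_filter; apply: (@card_bij_seq _ _ _ _ G).
- by rewrite filter_uniq // walks_uniq.
- move=> t t'; rewrite !mem_filter => /andP[/eqP tk tw] /andP[/eqP tk' tw'] E.
  have [[st vt] [st' vt']] := (tP _ tw, tP _ tw').
  have dE a c : a <= n -> c <= n ->
      walk_mult n (Pt t) a c = walk_mult n (Pt t') a c.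
    move=> an cn.
    have := GE t (Ordinal (an : a < n.+1), Ordinal (cn : c < n.+1)) tw tk.
    by rewrite E GE.
  apply: (@eq_from_nth _ (0, 0)) => [|i]; rewrite st ?st' // => i_n.
  apply: (@cnt_inj i.+1 (Pt t i.+1) (Pt t' i.+1)) => [||a ai];
    [exact: vt.1 | exact: vt'.1|].
  (* The recorded pairs are recovered from the multiplicities through [open_at]. *)
  rewrite -(open_at_walk_mult vt) ?ai // -(open_at_walk_mult vt') ?ai //.
  have an : a <= n by exact: leq_trans ai i_n.
  by congr addn; apply: eq_bigr => c _; apply: dE => //; rewrite -ltnS.
- move=> t; rewrite mem_filter => /andP[/eqP wtk tw]; have [st vt] := tP _ tw.
  rewrite inE; apply/andP; split.
    by rewrite (eq_bigr _ (fun p _ => GE t p tw wtk)) totP // wtP // wtk.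
  apply/forallP => l; rewrite -(covers_walk_mult vt (ltn_ord l : l <= n)).
  rewrite (pair_bigA _
    (fun a c : 'I_n.+1 => walk_mult n (Pt t) a c * coverage a c l)).
  by apply/eqP/eq_bigr => p _; rewrite GE.
move=> m; rewrite inE => /andP[/eqP mk /forallP ml].
pose f a c : nat := m (inord a, inord c).
have fE (p : 'I_n.+1 * 'I_n.+1) : f p.1 p.2 = m p.
  by rewrite /f !inord_val; case: (p).
have cf : covers n f.
  move=> l ln; have /eqP := ml (Ordinal (ln : l < n.+1)).
  rewrite (pair_bigA _ (fun a c : 'I_n.+1 => f a c * coverage a c l)) => <- /=.
  by apply: eq_bigr => p _; rewrite fE.
have [P vP PE] := covers_walkP cf.
have P0 : P 0 = (0, 0).
  by have := vP.1 0 isT; case: (P 0) => a b /= ?; congr pair; lia.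
pose t := mkseq (fun i => P i.+1) n.
have st : size t = n by rewrite size_mkseq.
have PtE l : l <= n -> Pt t l = P l.
  by case: l => [|l] ln; rewrite /Pt /= ?nth_mkseq.
have tw : t \in walks n 1 (0, 0).
  apply/walksP => //; split=> // i i_n; rewrite -/(Pt t i) nth_mkseq // !add1n.
  rewrite (PtE _ (ltnW i_n)); split=> [|x xi]; first exact: vP.1.
  exact: vP.2.
have wtk : (walk_weight 1 t).+1 = k.
  rewrite -wtP // -mk.
  transitivity (\sum_(p : 'I_n.+1 * 'I_n.+1) walk_mult n P p.1 p.2).
    by rewrite totP //; congr _.+1; apply: eq_bigr => i _; rewrite PtE.
  by apply: eq_bigr => p _; rewrite PE ?fE // -ltnS.
exists t; first by rewrite mem_filter wtk eqxx.
apply/ffunP => p; apply: val_inj.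
rewrite /= GE // -fE -PE ?leq_ord //.
by rewrite /walk_mult !PtE ?leq_ord // (leq_trans (leq_pred _)) ?leq_ord.
Qed.

(** * Generating functions *)

Local Open Scope ring_scope.

(** The flag tells whether the two recorded points coincide. Each strand starting at the new
    position costs a factor $q$; of two distinct points, either may be the one dropped, whence
    ['X *+ 2]. *)
Fixpoint walk_poly (n : nat) (diag : bool) : {poly int} :=
  if n is n'.+1 then
    if diag then (1 + 'X^2) * walk_poly n' true + 'X * walk_poly n' false
    else (1 + 'X *+ 2) * walk_poly n' false + 'X^2 * walk_poly n' true
  else 1.

Lemma sum_walk_weight n l v : (v.1 <= v.2 < l)%N ->
  \sum_(t <- walks n l v) 'X^(walk_weight l t) = walk_poly n (v.1 == v.2).
Proof.
elim: n l v => [|n IH] l [a b] /= /andP[ab bl]; first by rewrite big_seq1.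
rewrite big_allpairs_dep /=.
under eq_bigr => u _ do
  (under eq_bigr => t _ do rewrite exprD; rewrite -big_distrr /=).
have [la lb ll]: [/\ (a == l) = false, (b == l) = false & (l == l)].
  by split; lia.
rewrite /succs /=; case: eqVneq => [Eab|nab]; rewrite !big_cons big_nil.
  rewrite !IH /=; try lia.
  rewrite /cnt /= Eab !lb ll eqxx; ring.
rewrite !IH /=; try lia.
rewrite /cnt /= !la !lb ll (negPf nab); ring.
Qed.

(** Cayley-Hamilton for the transfer matrix with rows $(1+q^2, q)$ and $(q^2, 1+2q)$. *)
Lemma walk_poly_rec n : walk_poly n.+2 true =
  (2%:R + 2%:R * 'X + 'X^2) * walk_poly n.+1 true
  - (1 + 2%:R * 'X + 'X^2 + 'X^3) * walk_poly n true.
Proof. rewrite /=; ring. Qed.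

Lemma kostantC_walk_poly n : kostantC n.+1 = 'X * walk_poly n true.
Proof.
rewrite -(@sum_walk_weight n 1 (0, 0)%N) // big_distrr /= /kostantC.
under [LHS]eq_bigr => k _ do
  rewrite npartC_walks -sum1_count natr_sum big_mkcond scaler_suml.
rewrite exchange_big /= big_seq [RHS]big_seq; apply: eq_bigr => t tw.
have st : size t = n by have [] := (@walksP n 1 (0, 0)%N t isT).1 tw.
(* The weight is at most $2n$, so the exponent is below $2(n+1)$ and occurs in the sum over [k]. *)
rewrite -exprS (bigD1_seq (walk_weight 1 t).+1) ?iota_uniq //=; last first.
  by rewrite mem_index_iota; have := walk_weight_le 1 t; rewrite st; lia.
rewrite eqxx scale1r big1 ?addr0 // => k ne.
by rewrite eq_sym (negPf ne) scale0r.
Qed.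

(** Comparison of coefficients in $Dg = 1$, where $D$ is the quadratic denominator. *)
Lemma fps_inv_quadratic (R : comUnitRingType) (t d : R) :
  let g := fps_inv (fps_of_poly (1 - t%:P * 'X + d%:P * 'X ^+ 2)) in
  [/\ g 0 = 1, g 1 = t & forall n, g n.+2 = t * g n.+1 - d * g n].
Proof.
set D := 1 - _ + _; move=> g.
have D0 : D`_0 = 1 by rewrite /D !coefE /= ; ring.
have D1 : D`_1 = - t by rewrite /D !coefE /= ; ring.
have D2 : D`_2 = d by rewrite /D !coefE /= ; ring.
have D3 i : D`_i.+3 = 0 by rewrite /D !coefE /= ; ring.
have U : fps_of_poly D 0 \is a GRing.unit by rewrite /fps_of_poly D0 unitr1.
have E := fps_mulV U.
have g0 : g 0%N = 1.
  by have := E 0%N; rewrite /fps_mul big_ord1 /fps_of_poly coef1 D0 mul1r.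
split=> //.
  have := E 1%N; rewrite /fps_mul !big_ord_recl big_ord0 /fps_of_poly coef1 /=.
  rewrite D0 D1 -/g g0 mul1r mulr1 addr0 => /eqP.
  by rewrite subr_eq0 => /eqP.
move=> n; have := E n.+2.
rewrite /fps_mul !big_ord_recl /fps_of_poly coef1 /= big1 => [|i _]; last first.
  by rewrite D3 mul0r.
rewrite D0 D1 D2 !subSS !subn0 -/g => H.
transitivity ((1 * g n.+2 + (- t * g n.+1 + (d * g n + 0)))
   + t * g n.+1 - d * g n); last by rewrite H add0r.
ring.
Qed.

(** The numerator stops at degree 2, so both sides obey the same recurrence from index 3 on. The
    hypothesis on [f 2] is the degree 2 coefficient of [f] times the denominator. *)
Lemma fps_div_quadratic (R : comUnitRingType) (a b t d : R) (f : fps R) :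
  f 0 = 0 -> f 1 = a -> f 2 = t * a + b ->
  (forall n, f n.+3 = t * f n.+2 - d * f n.+1) ->
  f =1 fps_div (fps_of_poly (a%:P * 'X + b%:P * 'X ^+ 2))
        (fps_of_poly (1 - t%:P * 'X + d%:P * 'X ^+ 2)).
Proof.
move=> f0 f1 f2 fS; have [] := fps_inv_quadratic t d.
rewrite /fps_div; set g := fps_inv _ => g0 g1 gS.
set N := _ + _; set h := fps_mul _ _.
have N0 : N`_0 = 0 by rewrite /N !coefE /= ; ring.
have N1 : N`_1 = a by rewrite /N !coefE /= ; ring.
have N2 : N`_2 = b by rewrite /N !coefE /= ; ring.
have N3 i : N`_i.+3 = 0 by rewrite /N !coefE /= ; ring.
have h0 : h 0 = 0 by rewrite /h /fps_mul big_ord1 /fps_of_poly N0 mul0r.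
have h1 : h 1 = a.
  rewrite /h /fps_mul !big_ord_recl big_ord0 /fps_of_poly /= N0 N1 g0.
  by rewrite mul0r add0r mulr1 addr0.
have hS n : h n.+2 = a * g n.+1 + b * g n.
  rewrite /h /fps_mul !big_ord_recl /fps_of_poly big1 => [|i _]; last first.
    by rewrite N3 mul0r.
  by rewrite /= N0 N1 N2 !subSS !subn0 mul0r add0r addr0.
have h2 : h 2 = t * a + b by rewrite hS g0 g1; ring.
have hSS n : h n.+3 = t * h n.+2 - d * h n.+1.
  case: n => [|n]; last by rewrite !hS !gS; ring.
  by rewrite !hS !gS h1 g0 g1; ring.
suff H n : f n.+1 = h n.+1 /\ f n.+2 = h n.+2.
  by case=> [|n]; [rewrite f0 h0 | case: (H n)].
elim: n => [|n [IH1 IH2]]; first by rewrite f1 h1 f2 h2.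
by rewrite IH2; split=> //; rewrite fS hSS IH1 IH2.
Qed.

Theorem theorem4p3 :
  let q : {poly {poly int}} := 'X%:P in
  let x : {poly {poly int}} := 'X in
  kostantC_series =1
    fps_div
      (fps_of_poly (q * x + (- q - q ^+ 2) * x ^+ 2))
      (fps_of_poly (1 - (2%:R + 2%:R * q + q ^+ 2) * x
                      + (1 + 2%:R * q + q ^+ 2 + q ^+ 3) * x ^+ 2)).
Proof.
move=> q x.
(* Each coefficient, a polynomial in $q$, is gathered under a single [%:P] to fit the general
   quadratic form. *)
have -> : - q - q ^+ 2 = (- 'X - 'X ^+ 2)%:P by rewrite /q; ring.
have -> : 2%:R + 2%:R * q + q ^+ 2 = (2%:R + 2%:R * 'X + 'X ^+ 2)%:P.
  by rewrite /q; ring.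
have -> : 1 + 2%:R * q + q ^+ 2 + q ^+ 3
    = (1 + 2%:R * 'X + 'X ^+ 2 + 'X ^+ 3)%:P by rewrite /q; ring.
apply: fps_div_quadratic => [//|||n]; rewrite /= !kostantC_walk_poly.
- by rewrite mulr1.
- by rewrite /=; ring.
by rewrite walk_poly_rec; ring.
Qed.
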